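(* Assume that $\overline X$ has finite expectation, that $\hat F(t,x)>0$ a.s. for all $(t,x)\in\mathbb R^+\times\mathbb R^+$, and that there is a constant $L_{\hat F}\ge 0$ with $\operatorname{ess\,sup}_{\omega\in\Omega}|\hat F(t,x)-\hat F(t,\bar x)|\le L_{\hat F}|x-\bar x|$ for all $t,x,\bar x\in\mathbb R^+$. Suppose moreover that $\hat F(\omega,t,x)\equiv\tilde F(x)$ for some deterministic function $\tilde F$ on $\mathbb R^+$. Then the Hamilton--Jacobi equation $$r\hat V(x)=\frac{\big|\big(\partial_x\hat V(x)+\tilde F(x)\big)^+\big|^2}{4\tilde F(x)},\quad x\in\mathbb R^+,\qquad \lim_{x\to\infty}\hat V(x)=0,$$ and the ODE $$\psi'(x)=\sqrt{4r\psi(x)\tilde F(x)}-\tilde F(x),\quad x\ge0,\qquad \lim_{x\to\infty}\psi(x)=0,$$ have the same unique classical solution $\hat V$, and it satisfies $$0<\hat V(x)<\frac{\tilde F(x)}{4r},\qquad -\tilde F(x)<\partial_x\hat V(x)<0,\qquad x\in\mathbb R^+.$$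
   Context: $\mathbb R^+=[0,\infty)$ and $r>0$ is fixed. $(\Omega,\mathscr F,(\mathscr F_t)_{t\ge0},\mathbb P)$ is a filtered probability space satisfying the usual conditions, with $(\mathscr F_t)$ generated by a Wiener process (augmented). $\overline X$ is an $\mathscr F$-measurable nonnegative random variable with atomless law and unbounded support, and $\hat F(t,x):=\mathbb P(\overline X>x\mid\mathscr F_t)$. A classical solution is a $C^1$ function on $\mathbb R^+$ satisfying the equation pointwise together with the limit condition (for the ODE, $\psi\ge0$ so that the square root makes sense). *)

(* Defs.v *)
From HB Require Import structures.
From mathcomp Require Import all_boot all_order all_algebra.
From mathcomp Require Import all_classical all_reals all_analysis.
From mathcomp Require Import ess_sup_inf.

Set Implicit Arguments.
Unset Strict Implicit.
Unset Printing Implicit Defensive.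

Import Order.TTheory GRing.Theory Num.Theory.
Import numFieldNormedType.Exports.

Local Open Scope classical_set_scope.
Local Open Scope ring_scope.

Section filtrations.
Context {R : realType} {d : measure_display} {Omega : measurableType d}.
Variable P : probability Omega R.

Definition filtration (Ft : R -> set_system Omega) : Prop :=
  [/\ forall t, 0 <= t -> sigma_algebra setT (Ft t),
      forall t, 0 <= t -> Ft t `<=` measurable
    & forall s t, 0 <= s -> s <= t -> Ft s `<=` Ft t].

Definition usual_conditions (Ft : R -> set_system Omega) : Prop :=
  [/\ measure_is_complete P,
      forall N, P.-negligible N -> Ft 0 N
    & forall t, 0 <= t -> Ft t = \bigcap_(s in [set s | t < s]) Ft s].

(* The events {W_s \in B} for 0 <= s <= t and B Borel. *)
Definition past_events (W : R -> Omega -> R) (t : R) : set_system Omega :=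
  [set A | exists s B, [/\ 0 <= s, s <= t, measurable B & A = W s @^-1` B]].

Definition increment (W : R -> Omega -> R) (s t : R) : Omega -> R :=
  fun w => W t w - W s w.

(* The second argument of normal_prob is the standard deviation. *)
Definition wiener_process (W : R -> {RV P >-> R}) : Prop :=
  [/\ {ae P, forall w, W 0 w = 0},
      {ae P, forall w, {within `[0, +oo[, continuous (fun t => W t w)}},
      forall s t, 0 <= s -> s < t -> forall B : set R, measurable B ->
        P (increment W s t @^-1` B) = normal_prob 0 (Num.sqrt (t - s)) B
    & forall s t, 0 <= s -> s < t ->
        forall A, <<s past_events W s >> A ->
        forall B : set R, measurable B ->
        P (A `&` increment W s t @^-1` B) = (P A * P (increment W s t @^-1` B))%E].

Definition augmented_filtration (W : R -> Omega -> R) (t : R) :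
    set_system Omega :=
  <<s past_events W t `|` P.-negligible >>.

(* f is a version of the conditional probability P(E | G). *)
Definition is_cond_prob (G : set_system Omega) (E : set Omega)
    (f : Omega -> R) : Prop :=
  [/\ forall B : set R, measurable B -> G (f @^-1` B),
      P.-integrable setT (EFin \o f)
    & forall A, G A -> (\int[P]_(w in A) (f w)%:E = P (A `&` E))%E].

Definition atomless_law (X : {RV P >-> R}) : Prop :=
  forall x : R, distribution P X [set x] = 0%E.

Definition law_support (X : {RV P >-> R}) : set R :=
  [set x | forall U : set R, open U -> U x -> (0 < distribution P X U)%E].

End filtrations.

Section classical_solutions.
Context {R : realType}.
Implicit Types (f V psi F : R -> R) (r x : R).

(* Derivatives relative to [0, +oo[: two-sided at x > 0, right-sided at 0.
   Values of f outside [0, +oo[ are irrelevant. *)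
Definition diff_quotient f x : R -> R := fun y => (f y - f x) / (y - x).

Definition Rplus_derivable f x : Prop :=
  cvg (diff_quotient f x @ within `[0, +oo[ x^').

Definition Rplus_derive f x : R :=
  lim (diff_quotient f x @ within `[0, +oo[ x^').

Definition C1_Rplus f : Prop :=
  (forall x, 0 <= x -> Rplus_derivable f x) /\
  {within `[0, +oo[, continuous (Rplus_derive f)}.

Definition HJ_solution r F V : Prop :=
  [/\ C1_Rplus V,
      forall x, 0 <= x ->
        r * V x = `|Num.max (Rplus_derive V x + F x) 0| ^+ 2 / (4 * F x)
    & V x @[x --> +oo] --> (0 : R)].

Definition ODE_solution r F psi : Prop :=
  [/\ C1_Rplus psi,
      forall x, 0 <= x -> 0 <= psi x,
      forall x, 0 <= x ->
        Rplus_derive psi x = Num.sqrt (4 * r * psi x * F x) - F x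
    & psi x @[x --> +oo] --> (0 : R)].

(* Functions are identified when they agree on [0, +oo[. *)
Definition unique_on_Rplus (S : (R -> R) -> Prop) V : Prop :=
  S V /\ forall U, S U -> forall x, 0 <= x -> U x = V x.

End classical_solutions.

(* Main.v *)
Require Import Defs.
From HB Require Import structures.
From mathcomp Require Import all_boot all_order all_algebra.
From mathcomp Require Import all_classical all_reals all_analysis.
From mathcomp Require Import ess_sup_inf.
From mathcomp Require Import ring lra.

Set Implicit Arguments.
Unset Strict Implicit.
Unset Printing Implicit Defensive.

Import Order.TTheory GRing.Theory Num.Theory.
Import numFieldNormedType.Exports.

Local Open Scope classical_set_scope.
Local Open Scope ring_scope.

(** A solution of the Hamilton-Jacobi equation is nonnegative, and where
    [V' + F < 0] it would vanish, hence be minimal and have [V' >= 0].  So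
    [V' + F >= 0] and taking square roots gives [V' = sqrt (4 r V F) - F].
    Uniqueness holds because the square of the difference of two solutions is
    nondecreasing and tends to [0].

    For existence put [u = F / (4 r)], where the right-hand side vanishes.  The
    decaying solution [s] of the linear equation [s' = 2 r s - F / 2] satisfies
    [0 < s <= u] and is a lower barrier: by AM-GM it satisfies
    [s' >= sqrt (4 r s F) - F].  With [lam = (r + F / s) / 2] the
    map [h v = lam v + F - sqrt (4 r v F)] is nondecreasing in [v >= s], and
    [E = exp (- 5 r x / 2) s] satisfies [E' = - lam E].  So the equation reads
    [(E V)' = - E h(V)], that is, [V] is a fixed point of the monotone operator
    [v |-> E^-1 * (integral of E h(v) over [x, +oo[)], which maps [[s, u]] to
    itself and whose values all have the increments of the integral of [lam u]
    as modulus of continuity.  As in Knaster-Tarski, the supremum of the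
    subsolutions with that modulus is then a fixed point. *)

(** * Calculus on the line: antiderivatives and improper integrals *)

Section real_functions.
Context {R : realType}.
Implicit Types (f k E I u : R -> R) (x y l a : R).

Lemma is_derive_continuous f x l : is_derive x 1 f l -> {for x, continuous f}.
Proof. by case=> df _; exact/differentiable_continuous/derivable1_diffP. Qed.

Lemma is_derive_ndecr f f' a :
  (forall x, a <= x -> is_derive x 1 f (f' x)) ->
  (forall x, a <= x -> 0 <= f' x) ->
  forall x y, a <= x -> x <= y -> f x <= f y.
Proof.
move=> df f'0; apply: ger0_derive1_ndecry => [x|x|].
- by rewrite in_itv/= andbT => /ltW/df[].
- rewrite in_itv/= andbT => /ltW ax.
  by rewrite derive1E; have [_ ->] := df _ ax; exact: f'0.
- apply: derivable_within_continuous => x.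
  by rewrite in_itv/= andbT => /df[].
Qed.

Lemma ndecry_le0 f a : (forall x y, a <= x -> x <= y -> f x <= f y) ->
  f x @[x --> +oo] --> (0 : R) -> forall x, a <= x -> f x <= 0.
Proof.
move=> fnd f0 x ax; apply: (cvgr_to_ge f0).
by near=> y; apply: fnd => //; near: y; apply: nbhs_pinfty_ge; exact: num_real.
Unshelve. all: by end_near. Qed.

(** Since [k] vanishes on the left of 0, its integral over []-oo, x]] is really one over a compact
    interval, so the fundamental theorem of calculus applies at every [x] with a single formula. *)
Lemma antiderivative_half k : continuous k -> (forall x, x <= 0 -> k x = 0) ->
  exists K : R -> R, forall x, is_derive x 1 K (k x).
Proof.
move=> ck k0.
exists (fun x => \int[lebesgue_measure]_(t in [set` Interval -oo%O (BRight x)]) k t).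
move=> x.
have ik : lebesgue_measure.-integrable [set` Interval -oo%O (BRight (x + 1))]
    (EFin \o k).
  apply/integrable_mkcond => //.
  rewrite (_ : _ \_ _ = (EFin \o k) \_ `[0, x + 1]); last first.
    apply/funext => t; rewrite !patchE; case: (leP t 0) => t0.
      by rewrite /= k0//; case: ifP; case: ifP.
    congr (if _ then _ else _); apply/idP/idP; rewrite !inE/= !in_itv/=.
      by move=> ->; rewrite (ltW t0).
    by move=> /andP[].
  rewrite -integrable_mkcond//.
  apply: continuous_compact_integrable; first exact: segment_compact.
  exact: continuous_subspaceT.
have xx1 : x < x + 1 by rewrite ltrDl.
have [dK K'] := continuous_FTC1 xx1 ik (ltNyr _) (ck x).
by split; [exact: dK|rewrite -K' derive1E].
Qed.

(** [k - k 0] is cut at 0 into two pieces, each vanishing on one half-line. The left piece is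
    handled after the reflection [x |-> - x], and the linear term [k 0 * x] restores the
    constant. *)
Lemma antiderivative k : continuous k ->
  exists K : R -> R, forall x, is_derive x 1 K (k x).
Proof.
move=> ck.
have cmax : continuous (fun x : R => Num.max x 0).
  by move=> x; apply: continuous_max; [exact: cvg_id|exact: cvg_cst].
have [|x x0|K1 dK1] := @antiderivative_half (fun x => k (Num.max x 0) - k 0).
- move=> x; apply: cvgB; last exact: cvg_cst.
  by apply: (continuous_comp (cmax x)); exact: ck.
- by rewrite max_r// subrr.
have [|x x0|K2 dK2] := @antiderivative_half (fun x => k (- Num.max x 0) - k 0).
- move=> x; apply: cvgB; last exact: cvg_cst.
  apply: (@continuous_comp _ _ _ (fun x => - Num.max x 0) k); last exact: ck.
  by apply: cvgN; exact: cmax.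
- by rewrite max_r// oppr0 subrr.
exists (K1 - (K2 \o -%R) + (fun x => k 0 * x)) => x.
pose D1 := dK1 x; pose D2 := dK2 (- x).
have D3 : is_derive x 1 (K2 \o -%R) (- (k (- Num.max (- x) 0) - k 0)).
  by rewrite -mulrN1; exact: is_derive1_comp.
apply: is_derive_eq; rewrite scaler1.
have [x0|x0] := leP x 0; first by rewrite max_l ?opprK ?oppr_ge0//; ring.
rewrite max_r ?oppr_le0 ?ltW// oppr0; ring.
Qed.

(* [I x] is the improper integral of [k] over [[x, +oo[]. *)
Definition is_tail k I : Prop :=
  (forall x, is_derive x 1 I (- k x)) /\ I x @[x --> +oo] --> (0 : R).

Lemma is_tail_continuous k I : is_tail k I -> continuous I.
Proof. by case=> dI _ x; exact: is_derive_continuous (dI x). Qed.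

Lemma is_tail_le k1 k2 I1 I2 : is_tail k1 I1 -> is_tail k2 I2 ->
  (forall x, k1 x <= k2 x) -> forall x, I1 x <= I2 x.
Proof.
move=> [dI1 I1y] [dI2 I2y] k12 x; rewrite -subr_le0.
pose f := I1 - I2.
have f0 : f x @[x --> +oo] --> (0 : R) by rewrite -(subrr 0); exact: cvgB.
apply: (ndecry_le0 (f := f) (a := x)) => //.
apply: (is_derive_ndecr (f' := fun y => - k1 y - - k2 y)) => y _.
by rewrite opprK addrC subr_ge0.
Qed.

Lemma is_tail_ge0 k I : is_tail k I -> (forall x, 0 <= k x) -> forall x, 0 <= I x.
Proof.
move=> kI k0; apply: (is_tail_le (k1 := cst 0) (I1 := cst 0)) kI k0.
by split=> [z|]; [apply: is_derive_eq; rewrite oppr0|exact: cvg_cst].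
Qed.

(** A zero of [I] at [x] would persist on its right, because [I] is nonnegative and nonincreasing;
    the mean value theorem on [[x, x + 1]] then contradicts [0 < k]. *)
Lemma is_tail_gt0 k I : is_tail k I -> (forall x, 0 < k x) -> forall x, 0 < I x.
Proof.
move=> kI k0 x; have [dI Iy] := kI.
have Ige0 := is_tail_ge0 kI (fun z => ltW (k0 z)).
rewrite lt_neqAle Ige0 andbT; apply/negP => /eqP Ix0.
have Iz z : x <= z -> I z = 0.
  move=> xz; apply/eqP; rewrite eq_le Ige0 andbT -oppr_ge0.
  have -> : 0 = (- I) x by rewrite opprfctE -Ix0 oppr0.
  apply: (is_derive_ndecr (f' := k) (a := x)) => // y _; last exact: ltW.
  by rewrite -[k y]opprK; exact: is_deriveN.
have x1 : x < x + 1 by rewrite ltrDl.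
have cI : {within `[x, x + 1], continuous I}.
  exact: continuous_subspaceT (is_tail_continuous kI).
have [c _] := MVT x1 (fun z _ => dI z) cI.
rewrite Iz ?ltW// Iz// subrr => /esym/eqP.
by rewrite mulf_eq0 oppr_eq0 gt_eqF ?k0// addrC addKr oner_eq0.
Qed.

Section domination.
Context (E m k u I : R -> R).
Hypotheses (Em : is_tail m E) (Ik : is_tail k I).
Hypotheses (m0 : forall x, 0 <= m x) (kmu : forall x, k x <= m x * u x).
Hypothesis u_nincr : {homo u : x y / x <= y >-> y <= x}.

(** Beyond [x] the monotonicity of [u] gives [k <= m u <= m (u x)], so [I - (u x) E] has the
    nonnegative derivative [m (u x) - k]. *)
Let ndecr x y : x <= y -> I x - E x * u x <= I y - E y * u x.
Proof.
pose f := I - u x *: E; move=> xy.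
have -> : I x - E x * u x = f x by rewrite mulrC.
have -> : I y - E y * u x = f y by rewrite mulrC.
apply: (@is_derive_ndecr f (fun z => - k z - u x *: - m z) x) => // z xz.
  by have D1 := Em.1 z; have D2 := Ik.1 z; rewrite /f /=; apply: is_derive_eq.
rewrite scalerN opprK addrC subr_ge0 (le_trans (kmu z))// [leRHS]mulrC.
by rewrite ler_wpM2l// u_nincr.
Qed.

Lemma is_tail_le_mul x : I x <= E x * u x.
Proof.
rewrite -subr_le0.
have f0 : I y - E y * u x @[y --> +oo] --> (0 - 0 * u x : R).
  exact: cvgB Ik.2 (cvgM Em.2 (cvg_cst (u x))).
rewrite mul0r subr0 in f0.
apply: (cvgr_to_ge f0); near=> y; apply: ndecr.
by near: y; apply: nbhs_pinfty_ge; exact: num_real.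
Unshelve. all: by end_near. Qed.

(** At [y] the difference [I y - E y * u x] is already negative, by the weak bound at [y] and
    [u y < u x]; [ndecr] carries this back to [x]. *)
Lemma is_tail_lt_mul x y : 0 < E y -> x <= y -> u y < u x -> I x < E x * u x.
Proof.
move=> Ey xy uxy; rewrite -subr_lt0; apply: (le_lt_trans (ndecr xy)).
by rewrite subr_lt0; apply: (le_lt_trans (is_tail_le_mul y)); rewrite ltr_pM2l.
Qed.

End domination.

(** An antiderivative [K] of [k] is nondecreasing, and bounded above because [K + c E] is
    nonincreasing. The tail is the distance from [K] to its supremum. *)
Lemma is_tail_ex E m k (c : R) : is_tail m E -> 0 <= c -> continuous k ->
  (forall x, 0 <= m x) -> (forall x, 0 <= k x <= m x * c) ->
  exists I, is_tail k I.
Proof.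
move=> Em c0 ck m0 k_itv; have [K dK] := antiderivative ck.
have E0 := is_tail_ge0 Em m0.
have Knd x y : x <= y -> K x <= K y.
  by apply: (is_derive_ndecr (f' := k) (a := x)) => // z _; case/andP: (k_itv z).
have Kub x : K x <= K 0 + c * E 0.
  have [x0|/ltW x0] := leP x 0.
    by rewrite (le_trans (Knd _ _ x0))// lerDl mulr_ge0.
  apply: (@le_trans _ _ (K x + c * E x)); first by rewrite lerDl mulr_ge0.
  rewrite -lerN2.
  have dg (z : R) : is_derive z 1 (- (K + c *: E)) (- (k z + c *: - m z)).
    exact: is_deriveN (is_deriveD (dK z) (is_deriveZ c (Em.1 z))).
  apply: (is_derive_ndecr (fun z _ => dg z) _ (lexx 0) x0) => // z _.
  rewrite scalerN oppr_ge0 subr_le0 [leRHS]mulrC.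
  by case/andP: (k_itv z).
have Kcvg := nondecreasing_cvgr Knd _.
exists (cst (sup (range K)) - K); split=> [x|].
  by have D := dK x; apply: is_derive_eq; rewrite add0r.
rewrite -(subrr (sup (range K))); apply: cvgB; first exact: cvg_cst.
by apply: Kcvg; exists (K 0 + c * E 0) => _ [x _ <-].
Qed.

End real_functions.

(** * Existence of a decaying solution on the whole line *)

Section existence.
Context {R : realType}.
Variables (r B : R) (F : R -> R).
Hypothesis r0 : 0 < r.
Hypotheses (F0 : forall x, 0 < F x) (FB : forall x, F x <= B).
Hypotheses (F_nincr : {homo F : x y / x <= y >-> y <= x}) (cF : continuous F).
Hypothesis Fy : F x @[x --> +oo] --> (0 : R).
Implicit Types (x y : R) (v w : R -> R).

Let B0 : 0 < B. Proof. exact: lt_le_trans (F0 0) (FB 0). Qed.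

Let is_derive_expRM (c x : R) :
  is_derive x 1 (fun y => expR (c * y)) (c * expR (c * x)).
Proof.
rewrite mulrC; apply: (@is_derive1_comp _ expR (fun y => c * y)).
by apply: is_derive_eq; rewrite /GRing.scale/= mulr1.
Qed.

Let expRNM_to0 (c : R) : 0 < c -> expR (- c * x) @[x --> +oo] --> (0 : R).
Proof.
move=> c0; under eq_fun do rewrite mulNr.
apply: (@cvg_comp _ _ _ (fun x => c * x) (fun x => expR (- x)) _ +oo).
  by apply: gt0_cvgMry => //; exact: cvg_id.
exact: cvgr_expR.
Qed.

Let is_tail_expRNM (c : R) : 0 < c ->
  is_tail (fun x => c * expR (- c * x)) (fun x => expR (- c * x)).
Proof.
by move=> c0; split=> [x|]; [rewrite -mulNr; exact: is_derive_expRM|exact: expRNM_to0].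
Qed.

(** Variation of constants: [s] is [expR (2 r x)] times the tail of [k = e F / 2]. Since
    [k = (2 r e) (F / (4 r))] and [e] is the tail of [2 r e], the domination lemma bounds [s] by
    [F / (4 r)]. *)
Lemma lower_barrier : exists s : R -> R,
  (forall x, is_derive x 1 s (2 * r * s x - F x / 2)) /\
  (forall x, 0 < s x <= F x / (4 * r)).
Proof.
have r20 : 0 < 2 * r by rewrite mulr_gt0.
pose e x := expR (- (2 * r) * x).
pose k x := e x * (F x / 2).
have et := is_tail_expRNM r20.
have m0 x : 0 <= 2 * r * e x by rewrite mulr_ge0 ?expR_ge0 ?ltW.
have ck : continuous k.
  move=> x; apply: cvgM; last by apply: cvgM; [exact: cF|exact: cvg_cst].
  exact: is_derive_continuous (et.1 x).
have kE x : k x = 2 * r * e x * (F x / (4 * r)) by rewrite /k; field; rewrite gt_eqF.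
have k0 x : 0 < k x by rewrite mulr_gt0 ?expR_gt0// divr_gt0.
have [|x|I Ik] := is_tail_ex (c := B / (4 * r)) et _ ck m0.
- by rewrite divr_ge0 ?mulr_ge0 ?ltW.
- rewrite (ltW (k0 x))/= kE ler_wpM2l ?m0// ler_wpM2r// invr_ge0 mulr_ge0// ltW//.
pose s x := I x * expR (2 * r * x).
have eK x : e x * expR (2 * r * x) = 1.
  by rewrite -expRD mulNr addNr expR0.
exists s; split=> x.
  have D1 := Ik.1 x; have D2 := is_derive_expRM (2 * r) x.
  apply: (is_derive_eq (is_deriveM D1 D2)).
  rewrite /GRing.scale/= /s.
  transitivity (2 * r * (I x * expR (2 * r * x)) -
      F x / 2 * (e x * expR (2 * r * x))); last by rewrite eK mulr1.
  by rewrite /k; ring.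
rewrite mulr_gt0 ?expR_gt0 ?(is_tail_gt0 Ik)//=.
have kle y : k y <= 2 * r * e y * (F y / (4 * r)) by rewrite kE.
have u_nincr : {homo (fun y => F y / (4 * r)) : y z / y <= z >-> z <= y}.
  by move=> y z yz; rewrite ler_wpM2r ?F_nincr// invr_ge0 mulr_ge0 ?ltW.
have := is_tail_le_mul et Ik m0 kle u_nincr x.
rewrite -(ler_pM2r (expR_gt0 (2 * r * x))).
by rewrite [leRHS]mulrAC -/(e x) eK mul1r.
Qed.

(** * The monotone integral operator between the two barriers *)

Section fixpoint.
Variable s : R -> R.
Hypothesis ds : forall x, is_derive x 1 s (2 * r * s x - F x / 2).
Hypothesis s_itv : forall x, 0 < s x <= F x / (4 * r).

Let u x := F x / (4 * r).
Let s0 x : 0 < s x. Proof. by case/andP: (s_itv x). Qed.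
Let su x : s x <= u x. Proof. by case/andP: (s_itv x). Qed.
(** In the notation of the opening comment, [g] is [lam s], [m] is [lam E], [p x a] is [s h(a)] and
    [k v] is [E h(v)]: the factor [s] of [E] absorbs the division in [lam]. The rate [5 / 2 * r] is
    [2 r + r / 2], so that [s' / s = 2 r - F / (2 s)] leaves [E' / E = - lam]. *)
Let e x := expR (- (5 / 2 * r) * x).
Let E x := e x * s x.
Let g x := (r * s x + F x) / 2.
Let m x := e x * g x.
Let p x (a : R) := g x * a + s x * (F x - Num.sqrt (4 * r * a * F x)).
Let k v x := e x * p x (v x).

Let e0 x : 0 < e x. Proof. exact: expR_gt0. Qed.
Let E0 x : 0 < E x. Proof. by rewrite mulr_gt0. Qed.
Let g0 x : 0 < g x. Proof. by rewrite divr_gt0// addr_gt0// mulr_gt0. Qed.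
Let m0 x : 0 <= m x. Proof. by rewrite mulr_ge0// ltW. Qed.

Let sqrt4 x (a : R) : 0 <= a ->
  Num.sqrt (4 * r * a * F x) = 2 * Num.sqrt (r * a) * Num.sqrt (F x).
Proof.
move=> a0; have sqrt4 : Num.sqrt 4 = 2 :> R.
  by rewrite (_ : 4 = 2 ^+ 2) ?sqrtr_sqr ?ger0_norm//; ring.
have ra0 : 0 <= r * a by rewrite mulr_ge0// ltW.
rewrite -(mulrA 4) sqrtrM; last by rewrite mulr_ge0.
by rewrite (sqrtrM (r * a)) ?sqrt4.
Qed.

Let pE x (a : R) : 0 <= a ->
  p x a = g x * a + s x * (F x - 2 * Num.sqrt (r * a) * Num.sqrt (F x)).
Proof. by move=> a0; rewrite /p sqrt4. Qed.

Let sqF x : Num.sqrt (F x) ^+ 2 = F x. Proof. by rewrite sqr_sqrtr// ltW. Qed.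

Let amgm x : 2 * Num.sqrt (r * s x) * Num.sqrt (F x) <= r * s x + F x.
Proof.
have := sqr_ge0 (Num.sqrt (r * s x) - Num.sqrt (F x)).
by rewrite sqrrB sqF sqr_sqrtr ?mulr_ge0// ?(ltW r0) ?(ltW (s0 x))//; lra.
Qed.

(** The slope of [a |-> sqrt (4 r a F)] is [sqrt (r F / a)], at most [sqrt (r F / s)] when [s <= a],
    and AM-GM bounds the latter by [lam = g / s]. *)
Let p_homo x (a b : R) : s x <= a -> a <= b -> p x a <= p x b.
Proof.
move=> sa ab.
have a0 : 0 <= a by rewrite (le_trans _ sa)// ltW.
have b0 : 0 <= b by rewrite (le_trans a0).
rewrite !pE//.
have ss : Num.sqrt (r * s x) <= Num.sqrt (r * a).
  by rewrite ler_wsqrtr// ler_wpM2l// ltW.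
have sab : Num.sqrt (r * a) <= Num.sqrt (r * b).
  by rewrite ler_wsqrtr// ler_wpM2l// ltW.
have qa : Num.sqrt (r * a) ^+ 2 = r * a by rewrite sqr_sqrtr// mulr_ge0// ltW.
have qb : Num.sqrt (r * b) ^+ 2 = r * b by rewrite sqr_sqrtr// mulr_ge0// ltW.
have qs : Num.sqrt (r * s x) ^+ 2 = r * s x.
  by rewrite sqr_sqrtr// mulr_ge0// ltW.
have := amgm x; have := sqrtr_ge0 (r * s x); have := sqrtr_ge0 (F x).
move: qa qb qs ss sab.
set A := Num.sqrt (r * a); set C := Num.sqrt (r * b); set S := Num.sqrt (r * s x).
set f := Num.sqrt (F x) => qa qb qs ss sab f_ge0 S_ge0 am.
(* Multiplication by [r] turns the increment into a polynomial in the square roots with factor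
   [C - A]; the cofactor is nonnegative because [C + A >= 2 S] and [2 S f <= r s + F]. *)
rewrite -(ler_pM2l r0) -subr_ge0.
have -> : r * (g x * b + s x * (F x - 2 * C * f)) -
          r * (g x * a + s x * (F x - 2 * A * f)) =
          (C - A) * ((r * s x + F x) / 2 * (C + A) - 2 * S * f * S).
  transitivity (g x * (r * b - r * a) - (r * s x) * (2 * C * f - 2 * A * f)).
    by ring.
  by rewrite -qa -qb -{1}qs /g -qs; ring.
apply: mulr_ge0; first by rewrite subr_ge0.
rewrite subr_ge0 (@le_trans _ _ ((r * s x + F x) * S))//.
  by rewrite ler_wpM2r.
rewrite -[leRHS]mulrA; apply: ler_wpM2l; last by lra.
by rewrite ltW// addr_gt0// mulr_gt0.
Qed.

Let p_u x : p x (u x) = g x * u x.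
Proof.
rewrite /p (_ : 4 * r * u x * F x = F x ^+ 2).
  by rewrite sqrtr_sqr ger0_norm ?ltW// subrr mulr0 addr0.
by rewrite /u; field; rewrite gt_eqF.
Qed.

(** AM-GM bounds [sqrt (r s) * sqrt F] by [g], and [4 r s <= F] bounds it by [F]; twice this product
    is what [p x (s x) / s x] subtracts from [g + F]. *)
Let p_s_ge0 x : 0 <= p x (s x).
Proof.
rewrite pE; last exact: ltW.
rewrite (mulrC (g x)) -mulrDr; apply: mulr_ge0; first exact: ltW.
have ss : Num.sqrt (r * s x) <= Num.sqrt (F x).
  apply: ler_wsqrtr; have := su x; rewrite /u ler_pdivlMr ?mulr_gt0// => h.
  by apply: le_trans h; have := mulr_ge0 (ltW r0) (ltW (s0 x)); lra.
have : Num.sqrt (r * s x) * Num.sqrt (F x) <= F x.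
  by rewrite -[leRHS]sqF expr2 ler_wpM2r.
have := amgm x; rewrite /g; lra.
Qed.

Let cu : continuous u.
Proof. by move=> x; apply: cvgM; [exact: cF|exact: cvg_cst]. Qed.

Let cs : continuous s. Proof. by move=> x; exact: is_derive_continuous (ds x). Qed.

Let ce : continuous e.
Proof. by move=> x; exact: is_derive_continuous (is_derive_expRM _ x). Qed.

Let cg : continuous g.
Proof.
move=> x; apply: cvgM; last exact: cvg_cst.
by apply: cvgD; [apply: cvgM; [exact: cvg_cst|exact: cs]|exact: cF].
Qed.

Let ck v : continuous v -> continuous (k v).
Proof.
move=> cv x; apply: cvgM; first exact: ce.
apply: cvgD; first by apply: cvgM; [exact: cg|exact: cv].
apply: cvgM; first exact: cs.
apply: cvgB; first exact: cF.
apply: (@continuous_comp _ _ _ (fun y => 4 * r * v y * F y) Num.sqrt); last first.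
  exact: sqrt_continuous.
apply: cvgM; last exact: cF.
by apply: cvgM; [exact: cvg_cst|exact: cv].
Qed.

Let u_nincr : {homo u : x y / x <= y >-> y <= x}.
Proof. by move=> x y xy; rewrite ler_wpM2r ?F_nincr// invr_ge0 mulr_ge0 ?ltW. Qed.

Let r52 : 0 < 5 / 2 * r. Proof. by rewrite mulr_gt0// divr_gt0. Qed.

Let dE x : is_derive x 1 E (- m x).
Proof.
have D := is_derive_expRM (- (5 / 2 * r)) x.
apply: (is_derive_eq (is_deriveM D (ds x))).
by rewrite /GRing.scale/= /m /g -/(e x); field.
Qed.

Let Em : is_tail m E.
Proof.
split=> //.
have eB : e x * (B / (4 * r)) @[x --> +oo] --> (0 * (B / (4 * r)) : R).
  by apply: cvgM; [exact: expRNM_to0|exact: cvg_cst].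
rewrite mul0r in eB.
apply: squeeze_cvgr (cvg_cst 0) eB; apply: nearW => x.
rewrite (ltW (E0 x))/= ler_wpM2l ?(ltW (e0 x))// (le_trans (su x))//.
by rewrite ler_wpM2r// invr_ge0 mulr_ge0 ?ltW.
Qed.

Let k_ge0 v x : s x <= v x -> 0 <= k v x.
Proof.
move=> sv; rewrite mulr_ge0 ?(ltW (e0 x))//.
exact: le_trans (p_s_ge0 x) (p_homo (lexx _) sv).
Qed.

Let k_le v x : s x <= v x <= u x -> k v x <= m x * u x.
Proof.
move=> /andP[sv vu]; rewrite -mulrA ler_wpM2l ?(ltW (e0 x))//.
by rewrite -p_u p_homo.
Qed.

Let uB x : u x <= B / (4 * r).
Proof. by rewrite ler_wpM2r// invr_ge0 mulr_ge0 ?ltW. Qed.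

Let k_tail v : continuous v -> (forall x, s x <= v x <= u x) ->
  exists I, is_tail (k v) I.
Proof.
move=> cv v_itv; apply: (is_tail_ex (c := B / (4 * r)) Em) => //.
- by rewrite divr_ge0 ?mulr_ge0 ?ltW.
- exact: ck.
- move=> x; rewrite k_ge0 ?(le_trans (k_le (v_itv x)))//; last by case/andP: (v_itv x).
  by rewrite ler_wpM2l.
Qed.

Let lu x := g x / s x * u x.

Let clu : continuous lu.
Proof.
move=> x; apply: cvgM; last exact: cu.
apply: cvgM; first exact: cg.
by apply: cvgV; [rewrite gt_eqF|exact: cs].
Qed.

(** * The supremum of the subsolutions *)

Section modulus.
Variable M : R -> R.
Hypothesis dM : forall x, is_derive x 1 M (lu x).

(** [M] is an antiderivative of [lu], which is [lam u]. Continuity of [v] is what gives [k v] a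
    tail; a supremum of continuous functions may lose continuity, but this common bound passes to
    suprema. *)
Definition modulus v := forall x y, x <= y -> `|v y - v x| <= M y - M x.

Let modulus_is_derive v v' : (forall x, is_derive x 1 v (v' x)) ->
  (forall x, `|v' x| <= lu x) -> modulus v.
Proof.
move=> dv v'le x y xy.
have dp (z : R) : is_derive z 1 (M + v) (lu z + v' z).
  exact: is_deriveD (dM z) (dv z).
have dm (z : R) : is_derive z 1 (M - v) (lu z - v' z).
  exact: is_deriveB (dM z) (dv z).
have := is_derive_ndecr (fun z _ => dp z) _ (lexx x) xy.
have := is_derive_ndecr (fun z _ => dm z) _ (lexx x) xy.
rewrite !fctE => hm hp; rewrite ler_norml; apply/andP; split.
  have /hp : forall z, x <= z -> 0 <= lu z + v' z.
    by move=> z _; have := v'le z; rewrite ler_norml => /andP[]; lra.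
  by rewrite -/(M x); lra.
have /hm : forall z, x <= z -> 0 <= lu z - v' z.
  by move=> z _; have := v'le z; rewrite ler_norml => /andP[]; lra.
lra.
Qed.

Let modulus_continuous v : modulus v -> continuous v.
Proof.
move=> vM x.
have vMn y : `|v x - v y| <= `|M x - M y|.
  have [/vM xy|/ltW/vM yx] := leP x y.
    by rewrite distrC (le_trans xy)// distrC ler_norm.
  by rewrite (le_trans yx)// ler_norm.
have cM : {for x, continuous M} by exact: is_derive_continuous (dM x).
apply/cvgrPdist_lt => eps eps0.
move/cvgrPdist_lt : cM => /(_ _ eps0); apply: filterS => y.
exact: le_lt_trans (vMn y).
Qed.

(** The last clause says that [v] lies below [I / E], its image under the operator. *)
Definition subsol v := [/\ forall x, s x <= v x <= u x, modulus v &
  exists2 I, is_tail (k v) I & forall x, E x * v x <= I x].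

Let subsol_s : subsol s.
Proof.
have s_itv' x : s x <= s x <= u x by rewrite lexx/=.
have [I Ik] := k_tail cs s_itv'.
split=> //.
  apply: modulus_is_derive ds _ => x.
  have rs : r * s x <= F x / 4.
    rewrite mulrC -ler_pdivlMr// (le_trans (su x))// /u le_eqVlt; apply/orP; left.
    by apply/eqP; field; rewrite gt_eqF.
  (* As [r s <= F / 4], this form shows [lu >= 5 / 8 F], while [s' = 2 r s - F / 2] lies between
     [- F / 2] and [0]. *)
  have -> : lu x = 5 / 8 * F x + F x * (F x / 4 - r * s x) / (2 * r * s x).
    by rewrite /lu /g /u; field; rewrite !gt_eqF.
  have : 0 <= F x * (F x / 4 - r * s x) / (2 * r * s x).
    rewrite divr_ge0 ?mulr_ge0 ?(ltW (F0 x)) ?(ltW (s0 x)) ?(ltW r0)//.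
    by rewrite subr_ge0.
  have := mulr_gt0 r0 (s0 x); have := F0 x.
  by rewrite ler_norml => ? ? ?; apply/andP; split; lra.
exists I => // x; rewrite -subr_le0.
pose f := E * s - I.
have df (y : R) : is_derive y 1 f
    (E y *: (2 * r * s y - F y / 2) + s y *: - m y - - k s y).
  exact: is_deriveB (is_deriveM (dE y) (ds y)) (Ik.1 y).
have fy : f y @[y --> +oo] --> (0 : R).
  rewrite -(subr0 (0 : R)); apply: cvgB; last exact: Ik.2.
  have eB : E y * (B / (4 * r)) @[y --> +oo] --> (0 * (B / (4 * r)) : R).
    by apply: cvgM; [exact: Em.2|exact: cvg_cst].
  rewrite mul0r in eB.
  apply: squeeze_cvgr (cvg_cst 0) eB; apply: nearW => y.
  rewrite mulr_ge0 ?(ltW (E0 y)) ?(ltW (s0 y))//=.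
  by rewrite ler_wpM2l ?(ltW (E0 y))// (le_trans (su y)).
apply: (ndecry_le0 (f := f) (a := x)) => // y z xy yz.
apply: (is_derive_ndecr (fun z _ => df z) _ (lexx y) yz) => t _.
rewrite /k pE ?(ltW (s0 t))// /GRing.scale/= /E /m /g.
set f' := Num.sqrt (F t); set S := Num.sqrt (r * s t).
have qf : f' ^+ 2 = F t := sqF t.
have qs : S ^+ 2 = r * s t by rewrite sqr_sqrtr// mulr_ge0// ltW.
(* The derivative of [E s - I] is [e s / 2] times the perfect square [(2 S - f') ^+ 2], so [E s - I]
   increases to its limit 0. *)
have -> : e t * s t * (2 * r * s t - F t / 2) + s t * - (e t * ((r * s t + F t) / 2)) -
  - (e t * ((r * s t + F t) / 2 * s t + s t * (F t - 2 * S * f'))) =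
  e t * s t / 2 * (4 * (r * s t) + F t - 4 * S * f') by field.
rewrite -qs -qf (_ : _ - _ = (2 * S - f') ^+ 2); last by ring.
by rewrite mulr_ge0 ?sqr_ge0// divr_ge0// mulr_ge0 ?(ltW (e0 t)) ?(ltW (s0 t)).
Qed.

Let V x := sup [set v x | v in subsol].

Let V_ub v x : subsol v -> v x <= V x.
Proof.
move=> Sv; apply: ub_le_sup; last by exists v.
by exists (u x) => _ [w [+ _ _] <-] => /(_ x)/andP[].
Qed.

Let V_le x (a : R) : (forall v, subsol v -> v x <= a) -> V x <= a.
Proof.
move=> h; apply: ge_sup; first by exists (s x), s.
by move=> _ [w Sw <-]; exact: h.
Qed.

Let V_itv x : s x <= V x <= u x.
Proof.
by rewrite V_ub//=; apply: V_le => v [/(_ x)/andP[]].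
Qed.

Let V_modulus : modulus V.
Proof.
move=> x y xy; rewrite ler_norml; apply/andP; split.
  suff : V x <= V y + (M y - M x) by lra.
  apply: V_le => v Sv; have [_ /(_ _ _ xy) + _] := Sv.
  by have := V_ub y Sv; rewrite ler_norml => ? /andP[]; lra.
suff : V y <= V x + (M y - M x) by lra.
apply: V_le => v Sv; have [_ /(_ _ _ xy) + _] := Sv.
by have := V_ub x Sv; rewrite ler_norml => ? /andP[]; lra.
Qed.

Let k_homo v w : (forall x, s x <= v x) -> (forall x, v x <= w x) ->
  forall x, k v x <= k w x.
Proof. by move=> sv vw x; rewrite ler_wpM2l ?(ltW (e0 x))// p_homo. Qed.

Let V_fix : exists2 I, is_tail (k V) I & forall x, E x * V x = I x.
Proof.
have cV := modulus_continuous V_modulus.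
have [I Ik] := k_tail cV V_itv.
have VI x : E x * V x <= I x.
  (* [I / E] bounds every subsolution [v], because [v <= V] and the operator is monotone; hence it
     bounds their supremum. *)
  rewrite mulrC -ler_pdivlMr//; apply: V_le => v [v_itv vM [J Jk vJ]].
  rewrite ler_pdivlMr// mulrC (le_trans (vJ x))//.
  apply: (is_tail_le Jk Ik); apply: k_homo => y; first by case/andP: (v_itv y).
  by apply: V_ub; split=> //; exists J.
exists I => // x; apply/eqP; rewrite eq_le VI/=.
(* [W] is the image of [V] under the operator. As [V <= W], monotonicity makes [W] a subsolution
   too, whence [W <= V]. *)
pose W y := I y * (E y)^-1.
have VW y : V y <= W y by rewrite ler_pdivlMr// mulrC.
have Wu y : W y <= u y.
  rewrite ler_pdivrMr// mulrC.
  by apply: (is_tail_le_mul Em Ik) => // z; exact: k_le.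
have W_itv y : s y <= W y <= u y.
  by rewrite Wu andbT (le_trans _ (VW y))//; case/andP: (V_itv y).
have dW (y : R) : is_derive y 1 W (g y / s y * W y - p y (V y) / s y).
  have En : E y != 0 by rewrite gt_eqF.
  have D := is_deriveM (Ik.1 y) (is_deriveV En (dE y)).
  apply: (is_derive_eq D); rewrite /GRing.scale/= /W /k /m /E.
  by field; rewrite !gt_eqF.
(* [W' = lam W - h(V)] is a difference of two terms in [[0, lam u]], hence at most [lam u] in
   absolute value. *)
have W_modulus : modulus W.
  apply: modulus_is_derive dW _ => y.
  have h1 : 0 <= g y / s y * W y <= lu y.
    have gs0 : 0 <= g y / s y by rewrite divr_ge0 ?(ltW (g0 y)) ?(ltW (s0 y)).
    apply/andP; split; last by rewrite ler_wpM2l.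
    by rewrite mulr_ge0// (le_trans (ltW (s0 y)))//; case/andP: (W_itv y).
  have h2 : 0 <= p y (V y) / s y <= lu y.
    have [sV Vu] := andP (V_itv y).
    rewrite divr_ge0 ?(ltW (s0 y))//=; last exact: le_trans (p_s_ge0 y) (p_homo (lexx _) sV).
    by rewrite /lu mulrAC ler_wpM2r ?invr_ge0 ?(ltW (s0 y))// -p_u p_homo.
  by move: h1 h2 => /andP[? ?] /andP[? ?]; rewrite ler_norml; apply/andP; split; lra.
have [J Jk] := k_tail (modulus_continuous W_modulus) W_itv.
rewrite mulrC -ler_pdivrMr//; apply: (@V_ub W x); split=> //.
exists J => // y; rewrite /W mulrC divfK ?gt_eqF//.
by apply: (is_tail_le Ik Jk); apply: k_homo => // z; case/andP: (V_itv z).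
Qed.

(** Differentiating [V = I / E] gives [lam V - h(V)], in which the [lam] terms cancel. *)
Lemma fixpoint_solution : exists V : R -> R,
  (forall x, is_derive x 1 V (Num.sqrt (4 * r * V x * F x) - F x)) /\
  (forall x, 0 < V x < F x / (4 * r)).
Proof.
have [I Ik VI] := V_fix; exists V; split=> x.
  have -> : V = (fun y => I y * (E y)^-1).
    by apply/funext => y; rewrite -VI mulrC mulKf// gt_eqF.
  have En : E x != 0 by rewrite gt_eqF.
  have D := is_deriveM (Ik.1 x) (is_deriveV En (dE x)).
  apply: (is_derive_eq D); rewrite -VI.
  have -> : E x * V x / E x = V x by rewrite mulrAC divff// mul1r.
  rewrite /GRing.scale/= /k /p /m /E.
  by field; rewrite !gt_eqF.
have /andP[sV Vu] := V_itv x; rewrite (lt_le_trans (s0 x))//=.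
rewrite -(ltr_pM2l (E0 x)) VI.
(* [F] is positive and tends to 0, so it drops below [F x] somewhere; this makes the upper bound
   strict. *)
have [y [xy Fxy]] : exists y, x <= y /\ F y < F x.
  near (+oo : set_system R) => y; exists y; split.
    by near: y; apply: nbhs_pinfty_ge; exact: num_real.
  by near: y; exact: (cvgr_lt _ Fy).
apply: (is_tail_lt_mul (u := u) Em Ik _ _ _ (E0 y) xy) => //.
- by move=> z; exact: k_le.
- by rewrite ltr_pM2r// invr_gt0 mulr_gt0.
Unshelve. all: by end_near. Qed.

End modulus.

Lemma barrier_solution : exists V : R -> R,
  (forall x, is_derive x 1 V (Num.sqrt (4 * r * V x * F x) - F x)) /\
  (forall x, 0 < V x < F x / (4 * r)).
Proof. by have [M dM] := antiderivative clu; exact: fixpoint_solution dM. Qed.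

End fixpoint.

Lemma decaying_solution : exists V : R -> R,
  (forall x, is_derive x 1 V (Num.sqrt (4 * r * V x * F x) - F x)) /\
  (forall x, 0 < V x < F x / (4 * r)).
Proof. by have [s [ds s_itv]] := lower_barrier; exact: barrier_solution ds s_itv. Qed.

End existence.

(** * Derivatives on the half-line, equivalence of the two equations, uniqueness *)

Section classical_solution_theory.
Context {R : realType}.
Implicit Types (f d V psi F : R -> R) (x y l r : R).

Local Notation Rplus_dnbhs x := (within `[0, +oo[%classic (x : R)^').

(** Makes the punctured half-line filter proper and lets limits along it be computed from the right,
    also at 0. *)
Lemma at_right_Rplus_dnbhs x : 0 <= x -> x^'+ `=>` Rplus_dnbhs x.
Proof.
move=> x0 A; rewrite /within/= => -[e /= e0 he].
exists e => //= y xey xy; apply: he => //=; first by rewrite gt_eqF.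
by rewrite in_itv/= andbT (le_trans x0)// ltW.
Qed.

Lemma Rplus_dnbhs_proper x : 0 <= x -> ProperFilter (Rplus_dnbhs x).
Proof.
move=> x0; apply: Build_ProperFilter_ex => A /(at_right_Rplus_dnbhs x0).
exact: filter_ex.
Qed.

Lemma Rplus_derive_lim f x l : 0 <= x ->
  diff_quotient f x @ Rplus_dnbhs x --> l -> Rplus_derive f x = l.
Proof.
by move=> x0; have := Rplus_dnbhs_proper x0 => pf; exact: cvg_lim.
Qed.

Lemma diff_quotient_cvgP f x l :
  (diff_quotient f x @ x^' --> l) <-> is_derive x 1 f l.
Proof.
have shiftE : (fun h => h^-1 *: ((f \o shift x) (h *: 1) - f x)) =
    diff_quotient f x \o shift x.
  apply/funext => h /=; rewrite /diff_quotient addrK mulrC.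
  by rewrite /GRing.scale/= mulr1.
have dE : (diff_quotient f x \o shift x) @ 0^' = diff_quotient f x @ x^'.
  rewrite eqEsubset; split=> A [e /= e0 he]; exists e => //= y ye y0.
    rewrite -[y](subrK x); apply: he; last by rewrite subr_eq0.
    by rewrite /= sub0r opprB.
  apply: he; last by rewrite -subr_eq0 addrK.
  by rewrite /= opprD addrCA subrr addr0 -[X in `|X|]add0r.
split=> [cf|[+ <-]]; last by rewrite /derivable /derive shiftE dE.
split; first by rewrite /derivable shiftE dE; exact: cvgP cf.
by rewrite /derive shiftE dE; exact: cvg_lim.
Qed.

Lemma is_derive_Rplus_derivable f x l : is_derive x 1 f l ->
  diff_quotient f x @ Rplus_dnbhs x --> l.
Proof. by move/diff_quotient_cvgP; apply: cvg_trans; exact/cvg_app/cvg_within. Qed.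

Lemma Rplus_is_derive f x : 0 < x -> Rplus_derivable f x ->
  is_derive x 1 f (Rplus_derive f x).
Proof.
move=> x0 df; apply/diff_quotient_cvgP.
apply: cvg_trans df; apply: cvg_app => A /= [e /= e0 he].
have := lt_nbhsr x0 => -[e' /= e'0 he'].
exists (Num.min e e'); first by rewrite /= lt_min e0.
move=> y /=; rewrite lt_min => /andP[ye ye'] yx; apply: he => //=.
by rewrite in_itv/= andbT ltW// he'.
Qed.

Lemma Rplus_derivable_at_right f x : 0 <= x -> Rplus_derivable f x ->
  f y @[y --> x^'+] --> f x.
Proof.
move=> x0 df.
have cq : diff_quotient f x y @[y --> x^'+] --> Rplus_derive f x.
  by apply: cvg_trans df; apply: cvg_app; exact: at_right_Rplus_dnbhs.
have cyx : y - x @[y --> x^'+] --> x - x.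
  by apply: cvgB; [exact: cvg_at_right_filter|exact: cvg_cst].
have : diff_quotient f x y * (y - x) + f x @[y --> x^'+] -->
    Rplus_derive f x * (x - x) + f x.
  by apply: cvgD; [exact: cvgM|exact: cvg_cst].
rewrite subrr mulr0 add0r; apply: cvg_trans; apply: near_eq_cvg.
near=> y; rewrite /diff_quotient divfK ?subrK// subr_eq0 gt_eqF//.
Unshelve. all: by end_near. Qed.

Lemma Rplus_derivable_continuous f :
  (forall x, 0 <= x -> Rplus_derivable f x) -> {within `[0, +oo[, continuous f}.
Proof.
move=> df; apply/continuous_within_itvcyP; split.
  move=> x; rewrite in_itv/= andbT => x0.
  exact: is_derive_continuous (Rplus_is_derive x0 (df _ (ltW x0))).
by apply: Rplus_derivable_at_right => //; exact: df.
Qed.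

Lemma is_derive_C1_Rplus f d : continuous d ->
  (forall x, is_derive x 1 f (d x)) ->
  C1_Rplus f /\ (forall x, 0 <= x -> Rplus_derive f x = d x).
Proof.
move=> cd df.
have dE x : 0 <= x -> Rplus_derive f x = d x.
  by move=> x0; apply: Rplus_derive_lim => //; exact: is_derive_Rplus_derivable.
split=> //; split=> [x x0|].
  exact: cvgP (is_derive_Rplus_derivable (df x)).
apply: (@subspace_eq_continuous _ _ _ d); last exact: continuous_subspaceT.
by move=> x; rewrite inE/= in_itv/= andbT => /dE.
Qed.

Lemma HJ_ODE_solution r F V : 0 < r -> (forall x, 0 <= x -> 0 < F x) ->
  HJ_solution r F V <-> ODE_solution r F V.
Proof.
move=> r0 F0; split=> [[C1V HJ Vy]|[C1V V0 ODE Vy]]; last first.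
  split=> // x x0; have Fx := F0 _ x0.
  rewrite ODE// subrK max_l ?sqrtr_ge0// ger0_norm ?sqrtr_ge0//.
  rewrite sqr_sqrtr ?mulr_ge0 ?V0 ?(ltW r0) ?(ltW Fx)//.
  by field; rewrite gt_eqF.
have V0 x : 0 <= x -> 0 <= V x.
  move=> x0; rewrite -(pmulr_rge0 _ r0) HJ// divr_ge0 ?exprn_ge0//.
  by rewrite mulr_ge0// ltW// F0.
have DV x : 0 <= x -> 0 <= Rplus_derive V x + F x.
  move=> x0; rewrite leNgt; apply/negP => neg.
  have Vx : V x = 0.
    apply/eqP; have := HJ _ x0; rewrite max_r ?(ltW neg)// normr0 expr0n mul0r.
    by move/eqP; rewrite mulf_eq0 gt_eqF.
  (* [V] is minimal at [x], so its quotients from the right are nonnegative; working from the right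
     covers [x = 0]. *)
  have : 0 <= Rplus_derive V x.
    have cq : diff_quotient V x y @[y --> x^'+] --> Rplus_derive V x.
      apply: cvg_trans (C1V.1 _ x0); apply: cvg_app.
      exact: at_right_Rplus_dnbhs.
    apply: (cvgr_to_ge cq); near=> y.
    have xy : x < y by near: y; exact: nbhs_right_gt.
    by rewrite /diff_quotient Vx subr0 divr_ge0 ?V0 ?subr_ge0 ?(le_trans x0)// ltW.
  by have := F0 _ x0; lra.
split=> // x x0; apply/eqP; rewrite eq_sym subr_eq; apply/eqP.
have Fx := F0 _ x0.
rewrite (_ : 4 * r * V x * F x = (Rplus_derive V x + F x) ^+ 2).
  by rewrite sqrtr_sqr ger0_norm ?DV.
have -> : 4 * r * V x * F x = r * V x * (4 * F x) by ring.
rewrite HJ// max_l ?DV// ger0_norm ?DV// divfK//.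
by rewrite mulf_neq0 ?gt_eqF.
Unshelve. all: by end_near. Qed.

Lemma ODE_solution_unique r F V U : 0 <= r -> (forall x, 0 <= x -> 0 <= F x) ->
  ODE_solution r F V -> ODE_solution r F U -> forall x, 0 <= x -> U x = V x.
Proof.
move=> r0 F0 [[dV _] V0 VE Vy] [[dU _] U0 UE Uy] x x0.
pose f := (U - V) * (U - V).
have df y : 0 < y -> is_derive y 1 f
    (2 * (U y - V y) * (Num.sqrt (4 * r * U y * F y) - Num.sqrt (4 * r * V y * F y))).
  move=> y0; have Du := Rplus_is_derive y0 (dU _ (ltW y0)).
  have Dv := Rplus_is_derive y0 (dV _ (ltW y0)).
  have D := is_deriveM (is_deriveB Du Dv) (is_deriveB Du Dv).
  apply: (is_derive_eq D); rewrite UE ?VE ?(ltW y0)//.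
  by rewrite /GRing.scale/= !fctE; ring.
have fnd y z : 0 <= y -> y <= z -> f y <= f z.
  apply: ger0_derive1_ndecry => [t|t|].
  - by rewrite in_itv/= andbT => /df[].
  - rewrite in_itv/= andbT => t0; rewrite derive1E; have [_ ->] := df _ t0.
    (* By this monotonicity the two factors of the derivative of [f] have the same sign. *)
    have mono a b : a <= b -> Num.sqrt (4 * r * a * F t) <= Num.sqrt (4 * r * b * F t).
      move=> ab; apply: ler_wsqrtr; rewrite ler_wpM2r ?F0 ?(ltW t0)//.
      by rewrite ler_wpM2l// mulr_ge0.
    have [VU|/ltW UV] := leP (V t) (U t).
      by rewrite !mulr_ge0 ?subr_ge0 ?mono.
    by rewrite mulr_le0 ?mulr_ge0_le0 ?subr_le0 ?mono.
  - have cU := Rplus_derivable_continuous dU.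
    have cV := Rplus_derivable_continuous dV.
    have cUV t : {for t, continuous ((U : subspace `[0, +oo[ -> R) - V)}.
      by apply: continuousB; [exact: cU|exact: cV].
    by move=> t; apply: continuousM; exact: cUV.
have fy : f y @[y --> +oo] --> ((0 - 0) * (0 - 0) : R).
  by apply: cvgM; exact: cvgB.
rewrite subrr mulr0 in fy.
have := ndecry_le0 fnd fy x0.
rewrite /f fctE -expr2 => f0; apply/eqP; rewrite -subr_eq0 -sqrf_eq0.
by rewrite eq_le f0 sqr_ge0.
Qed.

End classical_solution_theory.

(** * From the whole line to the half-line *)

Section deterministic_equation.
Context {R : realType}.
Variables (r L : R) (F : R -> R).
Hypotheses (r0 : 0 < r) (F0 : forall x, 0 <= x -> 0 < F x).
Hypothesis F_nincr : forall x y, 0 <= x -> x <= y -> F y <= F x.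
Hypothesis F_lip : forall x y, 0 <= x -> 0 <= y -> `|F x - F y| <= L * `|x - y|.
Hypothesis Fy : F x @[x --> +oo] --> (0 : R).

Lemma unique_classical_solution : exists V : R -> R,
  [/\ unique_on_Rplus (HJ_solution r F) V,
      unique_on_Rplus (ODE_solution r F) V
    & forall x, 0 <= x ->
        (0 < V x < F x / (4 * r)) /\ (- F x < Rplus_derive V x < 0)].
Proof.
(* [G] extends [F] to the left of 0 by the constant [F 0]: existence was proved on the whole line,
   while the hypotheses control [F] only on the half-line. *)
pose G x := F (Num.max x 0).
have GF x : 0 <= x -> G x = F x by move=> x0; rewrite /G max_l.
have max0 (x : R) : 0 <= Num.max x 0 by rewrite le_max lexx orbT.
have G0 x : 0 < G x by exact: F0.
have GB x : G x <= F 0 by exact: F_nincr.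
have G_nincr : {homo G : x y / x <= y >-> y <= x}.
  by move=> x y xy; apply: F_nincr => //; rewrite ge_max !le_max xy lexx !orbT.
have cG : continuous G.
  move=> x; apply/cvgrPdist_lt => eps eps0.
  have h0 : L * `|Num.max x 0 - Num.max y 0| @[y --> x]
      --> (L * `|Num.max x 0 - Num.max x 0| : R).
    apply: cvgM; first exact: cvg_cst.
    apply: cvg_norm; apply: cvgB; first exact: cvg_cst.
    by apply: continuous_max; [exact: cvg_id|exact: cvg_cst].
  rewrite subrr normr0 mulr0 in h0.
  near=> y; apply: (le_lt_trans (F_lip (max0 x) (max0 y))).
  by near: y; exact: (cvgr_lt _ h0).
have Gy : G x @[x --> +oo] --> (0 : R).
  apply: cvg_trans Fy; apply: near_eq_cvg; near=> x; apply/esym/GF.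
  by near: x; apply: nbhs_pinfty_ge; exact: num_real.
have [V [dV V_itv]] := decaying_solution r0 G0 GB G_nincr cG Gy.
have cV : continuous V by move=> x; exact: is_derive_continuous (dV x).
have [|C1V VE] := is_derive_C1_Rplus _ dV.
  move=> x; apply: cvgB; last exact: cG.
  apply: (@continuous_comp _ _ _ (fun y => 4 * r * V y * G y) Num.sqrt); last first.
    exact: sqrt_continuous.
  apply: cvgM; last exact: cG.
  by apply: cvgM; [exact: cvg_cst|exact: cV].
have Vy : V x @[x --> +oo] --> (0 : R).
  have uy : G x / (4 * r) @[x --> +oo] --> (0 / (4 * r) : R).
    by apply: cvgM; [exact: Gy|exact: cvg_cst].
  rewrite mul0r in uy; apply: squeeze_cvgr (cvg_cst 0) uy; apply: nearW => x.
  by have /andP[/ltW-> /ltW->] := V_itv x.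
have V_ODE : ODE_solution r F V.
  split=> //; first by move=> x _; have /andP[/ltW] := V_itv x.
  by move=> x x0; rewrite VE// GF.
have F0' x : 0 <= x -> 0 <= F x by move=> /F0/ltW.
have V_unique U : ODE_solution r F U -> forall x, 0 <= x -> U x = V x.
  exact: ODE_solution_unique (ltW r0) F0' V_ODE.
exists V; split.
- split; first exact/HJ_ODE_solution.
  by move=> U /(HJ_ODE_solution _ r0 F0); exact: V_unique.
- by split.
move=> x x0; have := V_itv x; rewrite VE// !GF// => /andP[V0 Vlt].
split; first by rewrite V0.
have Fx := F0 x0; rewrite -subr_gt0 opprK subrK sqrtr_gt0 !mulr_gt0//=.
(* [4 r V < F] gives [4 r V F < F ^+ 2], so the square root is below [F]. *)
rewrite subr_lt0 -[ltRHS](gtr0_norm Fx) -sqrtr_sqr ltr_sqrt ?exprn_gt0//.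
rewrite expr2 ltr_pM2r//; move: Vlt; rewrite ltr_pdivlMr ?mulr_gt0//.
by rewrite mulrC.
Unshelve. all: by end_near. Qed.

End deterministic_equation.

(** * The deterministic conditional survival function *)

Section conditional_survival.
Context {R : realType} {d : measure_display} {Omega : measurableType d}.
Variable P : probability Omega R.
Local Open Scope ereal_scope.

Lemma probability_ae_ex (Q : set Omega) : {ae P, forall w, Q w} -> exists w, Q w.
Proof.
have P0 : 0 < P [set: Omega] by rewrite probability_setT.
have := ae_properfilter_algebraOfSetsType P0 => ae_proper.
exact: filter_ex.
Qed.

(** Testing the conditional probability on the whole space, a member of [Ft t], identifies the
    constant with the probability of [X > x]. *)
Lemma cond_prob_cst (Ft : R -> set_system Omega) (X : {RV P >-> R})
    (t x a : R) (f : Omega -> R) :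
  filtration Ft -> (0 <= t)%R -> is_cond_prob P (Ft t) [set w | (x < X w)%R] f ->
  {ae P, forall w, f w = a} -> a%:E = ccdf X x.
Proof.
move=> [sigFt _ _] t0 [_ /integrableP[mf _] intf] fa.
have [Ft0 FtC _] := sigFt _ t0.
have FtT : Ft t setT by rewrite -(setD0 setT); exact: FtC.
have -> : ccdf X x = P (setT `&` [set w | (x < X w)%R]).
  rewrite setTI /ccdf /distribution /pushforward; congr (P _).
  by apply/seteqP; split=> w /=; rewrite in_itv/= andbT.
rewrite -intf//.
transitivity (\int[P]_(w in setT) cst a%:E w).
  rewrite integral_cst//; have := probability_setT P => /= PT.
  by rewrite -[LHS]mule1 -PT.
apply: ae_eq_integral => //; apply: filterS fa => w fw _.
by rewrite /= fw.
Qed.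

End conditional_survival.

Theorem corollary4p2 (R : realType) (r : R) (hr : 0 < r)
    (d : measure_display) (Omega : measurableType d) (P : probability Omega R)
    (Ft : R -> set_system Omega) (hFt : filtration Ft)
    (husual : usual_conditions P Ft)
    (W : R -> {RV P >-> R}) (hW : wiener_process W)
    (hgen : forall t, 0 <= t -> Ft t = augmented_filtration P W t)
    (X : {RV P >-> R}) (hXge0 : {ae P, forall w, 0 <= X w})
    (hXatomless : atomless_law X)
    (hXunbounded : ~ bounded_set (law_support X))
    (hXint : P.-integrable setT (EFin \o X))
    (Fhat : R -> R -> Omega -> R)
    (hFhat : forall t x, 0 <= t -> 0 <= x ->
      is_cond_prob P (Ft t) [set w | x < X w] (Fhat t x))
    (hFhat_gt0 : forall t x, 0 <= t -> 0 <= x ->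
      {ae P, forall w, 0 < Fhat t x w})
    (L : R) (hL : 0 <= L)
    (hFhat_lip : forall t x y, 0 <= t -> 0 <= x -> 0 <= y ->
      (ess_sup P (fun w => `|Fhat t x w - Fhat t y w|%:E)
        <= (L * `|x - y|)%:E)%E)
    (Ftilde : R -> R)
    (hdet : forall t x, 0 <= t -> 0 <= x ->
      {ae P, forall w, Fhat t x w = Ftilde x}) :
  exists V : R -> R,
    [/\ unique_on_Rplus (HJ_solution r Ftilde) V,
        unique_on_Rplus (ODE_solution r Ftilde) V
      & forall x, 0 <= x ->
          (0 < V x < Ftilde x / (4 * r)) /\
          (- Ftilde x < Rplus_derive V x < 0)].
Proof.
(* Evaluation at time 0 identifies [Ftilde] with the survival function of [X], which supplies its
   monotonicity and its limit at infinity. *)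
have FE x : 0 <= x -> (Ftilde x)%:E = ccdf X x.
  by move=> x0; apply: (cond_prob_cst hFt (lexx 0) (hFhat _ _ (lexx 0) x0)); exact: hdet.
apply: (@unique_classical_solution _ r L Ftilde hr).
- move=> x x0.
  (* The inequality does not involve [w], so a single point of an almost sure event proves it; the
     Lipschitz bound below is obtained likewise. *)
  have [w []] := probability_ae_ex (filterI (hFhat_gt0 _ _ (lexx 0) x0) (hdet _ _ (lexx 0) x0)).
  by move=> + <-.
- move=> x y x0 xy; rewrite -lee_fin !FE// ?(le_trans x0)//.
  exact: ccdf_nonincreasing.
- move=> x y x0 y0; have /ess_supP := hFhat_lip _ _ _ (lexx 0) x0 y0.
  move=> /(filterI (filterI (hdet _ _ (lexx 0) x0) (hdet _ _ (lexx 0) y0))).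
  by case/probability_ae_ex => w [[-> ->]]; rewrite lee_fin.
have /fine_cvg := cvg_ccdfy0 X; apply: cvg_trans; apply: near_eq_cvg.
by near=> x; rewrite /= -FE.
Unshelve. all: by end_near. Qed.
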